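(* For any two complex numbers $A, B \in \mathbb{C}$, at least one of the relations $A \leq B$, $A \geq B$ holds; and $\mathbb{C}$ is a totally ordered set under the relation $\leq$.
   Context: The relations $\leq$ and $\geq$ on $\mathbb{C}$ are defined as follows. Write $A = a_1 + a_2 i$, $B = b_1 + b_2 i$ with $a_1,a_2,b_1,b_2 \in \mathbb{R}$. Then $A \leq B$ means: $a_1 < b_1$, or ($a_1 = b_1$ and $a_2 \leq b_2$). And $A \geq B$ means: $a_1 > b_1$, or ($a_1 = b_1$ and $a_2 \geq b_2$). *)

(* Defs.v *)
From Stdlib Require Import Reals Relations.
From Coquelicot Require Import Coquelicot.
Open Scope R_scope.

Definition Cle (A B : C) : Prop :=
  Re A < Re B \/ (Re A = Re B /\ Im A <= Im B).

Definition Cge (A B : C) : Prop :=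
  Re A > Re B \/ (Re A = Re B /\ Im A >= Im B).

(* [order] is the standard library's record: reflexive, transitive and
   antisymmetric with respect to Leibniz equality. *)
Definition total_order {T : Type} (le : relation T) : Prop :=
  order T le /\ forall x y : T, le x y \/ le y x.

(* Main.v *)
Require Import Defs.
From Stdlib Require Import Reals Relations Lra.
From Coquelicot Require Import Coquelicot.
Open Scope R_scope.

(** [Cle] is the lexicographic order on pairs (real part, imaginary part), so
    everything reduces to linear arithmetic over the ordered field of reals:
    trichotomy of the real parts, then comparability of the imaginary parts on
    a tie, gives [Cle_or_Cge]; since [Cge] is the converse of [Cle]
    ([Cge_Cle]), that dichotomy is also the totality of the order. *)

Lemma Cge_Cle (A B : C) : Cge A B <-> Cle B A.
Proof. unfold Cge, Cle; lra. Qed.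

Lemma Cle_or_Cge (A B : C) : Cle A B \/ Cge A B.
Proof. unfold Cle, Cge; lra. Qed.

Lemma Cle_refl : reflexive C Cle.
Proof. intros A; unfold Cle; lra. Qed.

Lemma Cle_trans : transitive C Cle.
Proof. intros A B D; unfold Cle; lra. Qed.

Lemma Cle_antisym : antisymmetric C Cle.
Proof.
  intros [a1 a2] [b1 b2]; unfold Cle; simpl; intros HAB HBA.
  apply injective_projections; simpl; lra.
Qed.

Theorem mainTheorem3 :
  (forall A B : C, Cle A B \/ Cge A B) /\ total_order Cle.
Proof.
  split; [exact Cle_or_Cge | split].
  - split; [exact Cle_refl | exact Cle_trans | exact Cle_antisym].
  - intros A B; rewrite <- (Cge_Cle A B); apply Cle_or_Cge.
Qed.
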